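(* Let $p$ be a prime, $q=p^{f_K}$ with $f_K\ge1$, and let $T\rtimes U$ be a semidirect product where $T=\langle\tau\rangle$ and $U=\langle\upsilon\rangle$ are cyclic groups of orders $e$ and $f$, with $(e,p)=1$, $e\mid q^f-1$, and $\upsilon$ acting on $T$ by $x\mapsto x^q$. Let $\rho:T\rtimes U\to GL(V)$ be an irreducible representation over $\mathbb{F}_p$. Put $T_0=\ker(\rho_{|T})$, $\bar T=T/T_0$, $t=|\bar T|$, $\tilde U=C_U(\bar T)$, and let $\tilde\upsilon=\upsilon^s$ with $s=\mathrm{ord}_t^\times(q)$, a generator of $\tilde U$. Consider the restriction of the representation to $T\rtimes\tilde U$ over the algebraic closure $\bar{\mathbb{F}}_p$, and let $\chi$ be the character of a $(T\rtimes\tilde U)$-invariant subspace of dimension $1$ of $V\otimes_{\mathbb{F}_p}\bar{\mathbb{F}}_p$. Then $$\dim_{\mathbb{F}_p}V=\mathrm{lcm}\left(\frac{rw}{(r,f_K)},\,r\right),$$ where $r=\mathrm{ord}_t^\times(p)$ and $w=[\mathbb{F}_p(\beta):\mathbb{F}_p]$ with $\beta=\chi(\tilde\upsilon)$.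
   Context: $\mathrm{ord}_t^\times(a)$ denotes the multiplicative order of $a$ modulo $t$ (equal to $1$ if $t=1$). $(a,b)$ is the greatest common divisor. $C_U(\bar T)$ is the kernel of the map $U\to\mathrm{Aut}(\bar T)$ induced by the action of $U$ on $T$. *)

(* Defs.v *)
From HB Require Import structures.
From mathcomp Require Import all_boot all_order all_fingroup all_algebra.
From mathcomp Require Import all_solvable all_field mxrepresentation.

Set Implicit Arguments.
Unset Strict Implicit.
Unset Printing Implicit Defensive.

Import GRing.Theory.
Local Open Scope ring_scope.

(* Multiplicative order of a modulo t.  'Z_1 is a copy of Z/2, hence the
   separate case t = 1; the value is junk (1) when a is not a unit modulo t. *)
Definition mul_order (t a : nat) : nat :=
  if t == 1%N then 1%N
  else #[insubd (1%g : {unit 'Z_t}) (a%:R : 'Z_t)]%g.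

Lemma mul_orderP (t a k : nat) : (0 < t)%N -> coprime a t ->
  (mul_order t a %| k)%N = (a ^ k == 1 %[mod t])%N.
Proof.
move=> t_gt0 co_at; rewrite /mul_order; case: eqP => [->|/eqP t_neq1].
  by rewrite dvd1n !modn1 eqxx.
have t_gt1 : (1 < t)%N by case: t t_gt0 t_neq1 {co_at} => [|[]].
have Ua : (a%:R : 'Z_t) \is a GRing.unit by rewrite unitZpE // coprime_sym.
rewrite order_dvdn -val_eqE /= FinRing.val_unitX val_insubd Ua -natrX.
by rewrite -val_eqE /= !val_Zp_nat // (modn_small t_gt1).
Qed.

(* d = [F(z) : F] for z in an overfield K of F (along iota).  As K itself need
   not be finite dimensional over F, the simple extension F(z) is formed inside
   a finite extension E of F that embeds in K over F and contains z. *)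
Definition adjoin_degree_is (F K : fieldType) (iota : {rmorphism F -> K})
    (z : K) (d : nat) : Prop :=
  exists (E : fieldExtType F) (j : {rmorphism E -> K}) (b : E),
    [/\ forall a : F, j a%:A = iota a, j b = z
      & d = \dim <<1; b>>%VS].

Lemma adjoin_degree_is_uniq (F K : fieldType) (iota : {rmorphism F -> K})
    (z : K) (d1 d2 : nat) :
  adjoin_degree_is iota z d1 -> adjoin_degree_is iota z d2 -> d1 = d2.
Proof.
suff le d d' : adjoin_degree_is iota z d -> adjoin_degree_is iota z d' ->
    (d <= d')%N.
  by move=> h1 h2; apply/eqP; rewrite eqn_leq !le.
move=> [E1 [j1 [b1 [j1E j1b ->]]]] [E2 [j2 [b2 [j2E j2b ->]]]].
rewrite !dim_Fadjoin !dimv1 !muln1.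
have [p Dp] : exists p : {poly F}, minPoly 1 b2 = map_poly (in_alg E2) p.
  have /polyOver1P[p ->] := minPolyOver 1 b2.
  by exists p.
have mapj (E : fieldExtType F) (j : {rmorphism E -> K}) :
    (forall a, j a%:A = iota a) ->
    map_poly j (map_poly (in_alg E) p) = map_poly iota p.
  by move=> jE; rewrite -map_poly_comp; apply: eq_map_poly => a /=.
have rz : root (map_poly iota p) z.
  by rewrite -(mapj _ j2 j2E) -Dp -j2b fmorph_root root_minPoly.
have rb1 : root (map_poly (in_alg E1) p) b1.
  by rewrite -(fmorph_root j1) mapj // j1b.
have pE1 : map_poly (in_alg E1) p \is a polyOver 1%VS.
  by apply/polyOver1P; exists p.
have p_neq0 : p != 0.
  by rewrite -(map_poly_eq0 (in_alg E2)) -Dp monic_neq0 ?monic_minPoly.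
have := minPoly_dvdp pE1 rb1; move/dvdp_leq.
rewrite map_poly_eq0 => /(_ p_neq0); rewrite size_map_poly.
by rewrite -(size_map_poly (in_alg E2)) -Dp !size_minPoly.
Qed.

Lemma adjoin_degree_is_exists (F : finFieldType) (K : closedFieldType)
    (iota : {rmorphism F -> K}) (z : K) :
  integralOver iota z -> exists d, adjoin_degree_is iota z d.
Proof.
move=> int_z.
have dec : decidable_embedding iota.
  move=> y; have [/existsP ex|/existsPn nex] := boolP [exists x, y == iota x].
    by left; case: ex => x /eqP; exists x.
  by right=> -[x /eqP yx]; move: (nex x); rewrite yx.
have [p [mon_p pz0 irr_p]] := minPoly_decidable_closure dec int_z.
have p_neq0 := monic_neq0 mon_p.
pose E := SubFieldExtType pz0 irr_p.
exists (\dim <<1; (subfx_root iota z p : E)>>%VS), E, (@subfx_inj _ _ iota z p).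
exists (subfx_root iota z p); split=> //.
  by move=> a; rewrite /= (subfx_injZ pz0 p_neq0) rmorph1 mulr1.
exact: subfx_inj_root pz0 p_neq0.
Qed.

(* Main.v *)
Require Import Defs.
From HB Require Import structures.
From mathcomp Require Import all_boot all_order all_fingroup all_algebra.
From mathcomp Require Import all_solvable all_field mxrepresentation.

Set Implicit Arguments.
Unset Strict Implicit.
Unset Printing Implicit Defensive.

Import GRing.Theory.
Local Open Scope ring_scope.

(* Let v span the given line, with eigenvalues alpha = chi(tau) and beta, let
   phi be the Frobenius map on coordinates, g = gcd(r, f_K) and s = r / g.  The
   vectors phi^k(v) rho(upsilon)^i are joint eigenvectors of tau and upsilon^s
   for (alpha^(p^k q^i), beta^(p^k)); these pairs are distinct for k < d and
   i < s, where d = lcm(w, g), and those with k = d already occur at k = 0.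
   Hilbert 90 for a semilinear map of the joint eigenspace of (alpha, beta)
   lets one choose v such that phi^d(v) rho(upsilon)^j = v for some j, after
   which the d s vectors with k < d and i < s span a space stable under G and
   phi.  It contains a nonzero phi-fixed vector, so it is everything by
   irreducibility over F_p, and dim V = d s = lcm(r w / g, r). *)

(** * Multiplicative orders and arithmetic of gcd and lcm *)

Lemma mul_order_gt0 (a t : nat) : (0 < t)%N -> coprime a t ->
  (0 < mul_order t a)%N.
Proof.
move=> t_gt0 co_at; apply: (@dvdn_gt0 _ (totient t)); first by rewrite totient_gt0.
by rewrite mul_orderP // Euler_exp_totient.
Qed.

Lemma dvdn_mul_order_exp (p m t k : nat) : (0 < t)%N -> coprime p t ->
  (mul_order t (p ^ m) %| k)%N = (mul_order t p %| m * k)%N.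
Proof. by move=> t_gt0 co_pt; rewrite !mul_orderP ?coprimeXl // expnM. Qed.

(** Both sides have the same multiples: k is a multiple of the left one iff r divides m k, that is,
    iff r / g divides k, because r / g and m / g are coprime. *)
Lemma mul_order_exp (p m t : nat) : (0 < t)%N -> (0 < m)%N -> coprime p t ->
  mul_order t (p ^ m) = (mul_order t p %/ gcdn (mul_order t p) m)%N.
Proof.
move=> t_gt0 m_gt0 co_pt; set r := mul_order t p; set g := gcdn r m.
have g_gt0 : (0 < g)%N by rewrite gcdn_gt0 m_gt0 orbT.
have co_rm : coprime (r %/ g) (m %/ g).
  rewrite /coprime -(eqn_pmul2r g_gt0) muln_gcdl.
  by rewrite !divnK ?mul1n ?dvdn_gcdl ?dvdn_gcdr.
have dvdE k : (mul_order t (p ^ m) %| k)%N = (r %/ g %| k)%N.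
  rewrite dvdn_mul_order_exp // -(Gauss_dvdr k co_rm) -[RHS](dvdn_pmul2r g_gt0).
  by rewrite mulnAC !divnK ?dvdn_gcdl ?dvdn_gcdr.
by apply/eqP; rewrite eqn_dvd dvdE dvdnn -dvdE dvdnn.
Qed.

(** Converts the size d s of the orbit basis into the closed form of the theorem. *)
Lemma lcmn_gcdn_div (r w m : nat) : (0 < gcdn r m)%N ->
  ((lcmn w (gcdn r m)) * (r %/ gcdn r m))%N = lcmn ((r * w) %/ gcdn r m) r.
Proof.
move=> g_gt0; rewrite mulnC muln_lcmr divnK ?dvdn_gcdl //.
by rewrite divn_mulAC ?dvdn_gcdl.
Qed.

Lemma eqn_mod_lcm (m n a b : nat) :
  (a == b %[mod lcmn m n])%N = (a == b %[mod m])%N && (a == b %[mod n])%N.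
Proof.
wlog le_ba : a b / (b <= a)%N.
  move=> W; case: (leqP b a) => [/W //|/ltnW/W eq_ba].
  by rewrite eq_sym eq_ba; congr (_ && _); apply: eq_sym.
by rewrite !eqn_mod_dvd // dvdn_lcm.
Qed.

(** * Powers of the Frobenius map and their periods *)

Section Frobenius.

Variables (R : comNzRingType) (p : nat).

(** Taking the characteristic proof as an argument lets the ring morphism structure be attached to
    [frob] itself. *)
Definition frob of p \in [pchar R] := fun (k : nat) (x : R) => x ^+ (p ^ k).

Variables (pcharRp : p \in [pchar R]) (k : nat).
Local Notation phi := (frob pcharRp k).

Fact frob_is_zmod_morphism : zmod_morphism phi.
Proof.
move=> x y; have chp : [pchar R].-nat (p ^ k)%N.
  by rewrite pnatX pnatE ?(pcharf_prime pcharRp) // pcharRp.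
by rewrite /frob exprDn_pchar // exprNn_pchar.
Qed.

Fact frob_is_monoid_morphism : monoid_morphism phi.
Proof. by split=> [|x y]; rewrite /frob ?expr1n ?exprMn. Qed.

HB.instance Definition _ :=
  GRing.isZmodMorphism.Build R R phi frob_is_zmod_morphism.
HB.instance Definition _ :=
  GRing.isMonoidMorphism.Build R R phi frob_is_monoid_morphism.

End Frobenius.

Lemma frobD (R : comNzRingType) (p : nat) (pcharRp : p \in [pchar R]) j k x :
  frob pcharRp (j + k) x = frob pcharRp j (frob pcharRp k x).
Proof. by rewrite /frob -exprM -expnD addnC. Qed.

Lemma map_frobD (R : comNzRingType) (p : nat) (pcharRp : p \in [pchar R]) j k
    m n (A : 'M[R]_(m, n)) :
  map_mx (frob pcharRp (j + k)) A = map_mx (frob pcharRp j) (map_mx (frob pcharRp k) A).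
Proof. by apply/matrixP=> a b; rewrite !mxE frobD. Qed.

Lemma frob_periodic (R : comNzRingType) (p : nat) (pcharRp : p \in [pchar R]) k j x :
  frob pcharRp k x = x -> frob pcharRp (j * k) x = x.
Proof. by move=> kx; elim: j => [|j IHj]; rewrite ?mulSn ?frobD ?IHj // /frob expr1. Qed.

Section FrobeniusField.

Variables (K : fieldType) (p : nat) (pcharKp : p \in [pchar K]).
Local Notation phi := (frob pcharKp).

(** Frobenius powers are injective on a field, so the smaller of the two can be cancelled. *)
Lemma frob_eq_mod (d : nat) (x : K) : (forall k, (phi k x == x) = (d %| k)%N) ->
  forall i j, (phi i x == phi j x) = (i == j %[mod d])%N.
Proof.
move=> per_x i j; wlog le_ij : i j / (i <= j)%N.
  by move=> W; case: (leqP i j) => [/W //|/ltnW/W]; rewrite eq_sym [RHS]eq_sym.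
rewrite -(subnKC le_ij) frobD (inj_eq (fmorph_inj _)) eq_sym per_x.
by rewrite eq_sym eqn_mod_dvd ?leq_addr // addKn.
Qed.

Lemma frob_prim_root t (z : K) k : coprime p t -> t.-primitive_root z ->
  (phi k z == z) = (mul_order t p %| k)%N.
Proof.
move=> co_pt prim_z; have t_gt0 := prim_order_gt0 prim_z.
rewrite mul_orderP // -(eq_prim_root_expr prim_z) expr1 //.
Qed.

(** With q = p^m, the action of upsilon on eigenvalues of tau is itself a Frobenius power, so both
    actions on alpha are recorded by one exponent. *)
Lemma frob_exprX (x : K) m i k : phi k x ^+ ((p ^ m) ^ i) = phi (k + m * i) x.
Proof. by rewrite /frob -exprM -expnM -expnD. Qed.

End FrobeniusField.

Lemma frob_Fp (p : nat) (pcharFp : p \in [pchar 'F_p]) k (a : 'F_p) :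
  frob pcharFp k a = a.
Proof.
rewrite -[k]muln1; apply: frob_periodic; rewrite /frob expn1.
by have := expf_card a; rewrite (card_Fp (pcharf_prime pcharFp)).
Qed.

Lemma frob_rmorph (R S : comNzRingType) (p : nat) (pcharRp : p \in [pchar R])
    (pcharSp : p \in [pchar S]) (f : {rmorphism R -> S}) k x :
  frob pcharSp k (f x) = f (frob pcharRp k x).
Proof. by rewrite /frob rmorphXn. Qed.

(** * Frobenius on extensions of the prime field *)

Section OverFp.

Variables (p : nat) (p_prime : prime p) (K : fieldType).
Variables (iota : {rmorphism 'F_p -> K}) (pcharKp : p \in [pchar K]).
Local Notation phi := (frob pcharKp).

Lemma frob_iota k a : phi k (iota a) = iota a.
Proof. by rewrite (frob_rmorph (pchar_Fp p_prime)) frob_Fp. Qed.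

(** Evaluate at x the image under [iota] of the factorisation of X^p - X into the X - a with a in
    the prime field. *)
Lemma frob1_fixed x : phi 1 x = x -> exists a, x = iota a.
Proof.
move=> fix_x; have /eqP := congr1 (map_poly iota) (finField_genPoly 'F_p).
rewrite (card_Fp p_prime) rmorphB /= map_polyXn map_polyX rmorph_prod.
move=> /eqP/(congr1 (horner^~ x)); rewrite !hornerE.
move: fix_x; rewrite /frob expn1 => ->; rewrite subrr horner_prod => /esym/eqP.
case/prodf_eq0=> a _; rewrite /= map_polyXsubC hornerXsubC subr_eq0 => /eqP->.
by exists a.
Qed.

Lemma map_frob_iota k m n (A : 'M_(m, n)) :
  map_mx (phi k) (map_mx iota A) = map_mx iota A.
Proof. by apply/matrixP=> i j; rewrite !mxE frob_iota. Qed.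

Lemma frob1_fixed_mx m n (A : 'M_(m, n)) :
  map_mx (phi 1) A = A -> exists A0, A = map_mx iota A0.
Proof.
move=> fixA; have ex ij : exists a, A ij.1 ij.2 == iota a.
  have [] := @frob1_fixed (A ij.1 ij.2); first by rewrite -{2}fixA mxE.
  by move=> a ->; exists a.
exists (\matrix_(i, j) xchoose (ex (i, j))).
by apply/matrixP=> i j; rewrite !mxE; apply/eqP/(xchooseP (ex (i, j))).
Qed.

(** The degree of z is used later only as the exact period of Frobenius on z. *)
Lemma adjoin_degree_frob (z : K) d : adjoin_degree_is iota z d ->
  forall k, (phi k z == z) = (d %| k)%N.
Proof.
case=> E [j [b [_ <- ->]]]; set d0 := \dim _.
have pcharEp : p \in [pchar E] by rewrite pchar_lalg pchar_Fp.
have FermatE (L : {subfield E}) x : (x \in L) = (frob pcharEp (\dim L) x == x).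
  by rewrite Fermat's_little_theorem /= card_Fp.
have fix_d0 : frob pcharEp d0 b = b.
  by apply/eqP; rewrite -FermatE memv_adjoin.
have d0_gt0 : (0 < d0)%N by rewrite adim_gt0.
move=> k; rewrite (frob_rmorph pcharEp) (inj_eq (fmorph_inj j)).
apply/eqP/idP=> [fix_k | /dvdnP[l ->]]; last exact: frob_periodic.
have {fix_k} fix_c : frob pcharEp (k %% d0) b = b.
  by rewrite -{2}fix_k {2}(divn_eq k d0) addnC frobD (frob_periodic _ fix_d0).
rewrite /dvdn; case: posnP => // c_gt0; have := ltn_pmod k d0_gt0.
move: (k %% d0)%N c_gt0 fix_c => [//|c] _ fix_c.
(* Here [c.+1] is the nonzero remainder of k modulo [d0]. Frobenius permutes the factors cyclically,
   so [P] has coefficients in the prime field; it kills [b] with degree below that of the minimal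
   polynomial, a contradiction. *)
pose P := \prod_(i < c.+1) ('X - (frob pcharEp i b)%:P).
have fixP : map_poly (frob pcharEp 1) P = P.
  rewrite rmorph_prod [RHS]big_ord_recl big_ord_recr /= mulrC map_polyXsubC.
  congr (_ * _); first by rewrite /= -frobD add1n fix_c /frob expr1.
  by apply: eq_bigr => i _; rewrite map_polyXsubC /= -frobD.
have P1 : P \is a polyOver 1%AS.
  apply/polyOverP=> i; rewrite FermatE dimv1 -{2}fixP.
  by rewrite coef_map.
have rootP : root P b.
  by rewrite /P big_ord_recl rootM root_XsubC /frob expr1 eqxx.
have P_neq0 : P != 0 by rewrite monic_neq0 ?monic_prod_XsubC.
have := dvdp_leq P_neq0 (minPoly_dvdp P1 rootP).
rewrite size_minPoly size_prod_XsubC [index_enum _]unlock -enumT size_enum_ord.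
by rewrite ltnS leqNgt /d0 dim_Fadjoin dimv1 muln1 => /negPf->.
Qed.

End OverFp.

(** * Fixed vectors of semilinear maps and independence of joint eigenvectors *)

(** The polynomial X^(p^k) - X has derivative -1, so it splits with distinct roots. *)
Lemma frob_fixed_points (K : closedFieldType) (p : nat)
    (pcharKp : p \in [pchar K]) k : (0 < k)%N ->
  exists rs : seq K, [/\ uniq rs, size rs = (p ^ k)%N
    & forall x, x \in rs -> frob pcharKp k x = x].
Proof.
move=> k_gt0; have p_gt1 := prime_gt1 (pcharf_prime pcharKp).
have Q_gt1 : (1 < p ^ k)%N by rewrite -[1%N](expn0 p) ltn_exp2l.
pose P : {poly K} := 'X^(p ^ k) - 'X.
have sizeP : size P = (p ^ k).+1.
  by rewrite size_polyDl size_polyXn // size_polyN size_polyX ltnS.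
have [rs defP] := closed_field_poly_normal P.
have lcP : lead_coef P = 1.
  by rewrite lead_coefDl ?lead_coefXn // size_polyN size_polyX size_polyXn ltnS.
rewrite lcP scale1r in defP; exists rs; split.
- rewrite -separable_prod_XsubC -defP unlock /P !derivE.
  rewrite -scaler_nat natrX (pcharf0 pcharKp) expr0n gtn_eqF // scale0r add0r.
  by rewrite -[- 1]scaleN1r coprimepZr ?oppr_eq0 ?oner_eq0 // coprimep1.
- by move: sizeP; rewrite defP size_prod_XsubC => -[].
move=> x; rewrite -root_prod_XsubC -defP /root /P !hornerE subr_eq0.
by move/eqP.
Qed.

(* Artin independence of the characters c |-> c^(p^(d l)), obtained by counting
   roots of a p-polynomial. *)
Lemma frob_combination_neq0 (K : closedFieldType) (p : nat)
    (pcharKp : p \in [pchar K]) (d m n : nat) (x : nat -> 'rV[K]_n) :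
    (0 < d)%N -> (0 < m)%N -> x 0 != 0 ->
  exists2 c, frob pcharKp (d * m) c = c
    & \sum_(l < m) frob pcharKp (d * l) c *: x l != 0.
Proof.
move=> d_gt0 m_gt0 /rV0Pn[b xb_neq0].
have p_gt1 := prime_gt1 (pcharf_prime pcharKp).
have dm_gt0 : (0 < d * m)%N by rewrite muln_gt0 d_gt0.
have [rs [uniq_rs size_rs fix_rs]] := frob_fixed_points pcharKp dm_gt0.
pose P := \sum_(l < m) x l 0 b *: 'X^(p ^ (d * l)).
have hornerP c : P.[c] = (\sum_(l < m) frob pcharKp (d * l) c *: x l) 0 b.
  rewrite horner_sum summxE; apply: eq_bigr => l _.
  by rewrite !hornerE !mxE mulrC.
(* For l > 0 the exponent p^(d l) exceeds 1, so only l = 0 contributes to degree 1. *)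
have P1 : P`_1 = x 0 0 b.
  case: m m_gt0 @P {dm_gt0 size_rs fix_rs hornerP} => // m _ P.
  rewrite coef_sum big_ord_recl muln0 expn0 coefZ coefXn mulr1 big1 ?addr0 // => l _.
  rewrite coefZ coefXn [(_ == _)%N]ltn_eqF ?mulr0 //.
  by rewrite -[1%N](expn0 p) ltn_exp2l // muln_gt0 d_gt0.
have P_neq0 : P != 0 by apply: contraNneq xb_neq0 => P0; rewrite -P1 P0 coef0.
have sizeP : (size P <= p ^ (d * m))%N.
  apply: (leq_trans (size_sum _ _ _)); apply/bigmax_leqP => l _.
  apply: (leq_trans (size_scale_leq _ _)).
  by rewrite size_polyXn ltn_exp2l // ltn_pmul2l.
have : ~~ all (root P) rs.
  apply/negP=> rootP; have := max_poly_roots P_neq0 rootP uniq_rs.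
  by rewrite size_rs ltnNge sizeP.
case/allPn=> c rs_c; rewrite /root hornerP => nz.
by exists c; [apply: fix_rs | apply: contraNneq nz => ->; rewrite mxE].
Qed.

(* Hilbert 90 in the form of averaging over the semilinear map
   x |-> x^(p^d) *m A. *)
Lemma semilinear_fixed (K : closedFieldType) (p : nat)
    (pcharKp : p \in [pchar K]) (d m n k : nat) (A : 'M[K]_n) (W : 'M[K]_(k, n))
    (Phi := fun x : 'rV_n => map_mx (frob pcharKp d) x *m A) (v : 'rV_n) :
    (0 < d)%N -> (0 < m)%N -> v != 0 -> iter m Phi v = v ->
    (v <= W)%MS -> (forall x : 'rV_n, (x <= W)%MS -> (Phi x <= W)%MS) ->
  exists y : 'rV_n, [/\ y != 0, (y <= W)%MS & Phi y = y].
Proof.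
move=> d_gt0 m_gt0 v_neq0 per_v Wv stabW.
have [c fix_c nz] :=
  @frob_combination_neq0 _ _ pcharKp d m n (fun l => iter l Phi v)
    d_gt0 m_gt0 v_neq0.
set y := \sum_(l < m) _ in nz; exists y; split=> //.
  apply: summx_sub => l _; apply: scalemx_sub.
  by elim: (l : nat) => //= i IHi; apply: stabW.
have PhiE : Phi y = \sum_(l < m) frob pcharKp (d * l.+1) c *: iter l.+1 Phi v.
  rewrite /Phi raddf_sum /= mulmx_suml; apply: eq_bigr => l _ /=.
  by rewrite map_mxZ /= -scalemxAl -frobD mulnS.
(* [Phi] shifts the sum by one index, and the last term wraps around to the first because both [v]
   and [c] are periodic. *)
rewrite PhiE /y; case: m m_gt0 per_v fix_c {nz y PhiE} => // m _ per_v fix_c.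
rewrite big_ord_recr big_ord_recl /= addrC; congr (_ + _).
by rewrite -[Phi _]/(iter m.+1 Phi v) per_v fix_c muln0 /frob expr1.
Qed.

(* For each i, a polynomial in A and B kills the other vectors and rescales the
   i-th one. *)
Lemma joint_eigenvectors_free (K : fieldType) (n m : nat) (A B : 'M[K]_n)
    (x : 'I_m -> 'rV[K]_n) (a b : 'I_m -> K) :
    (forall i, x i != 0) -> (forall i, x i *m A = a i *: x i) ->
    (forall i, x i *m B = b i *: x i) -> injective (fun i => (a i, b i)) ->
  row_free (\matrix_i x i).
Proof.
move=> x_neq0 xA xB inj_ab; rewrite -kermx_eq0; apply/rowV0P => u /sub_kermxP.
rewrite mulmx_sum_row => sum0; apply/rowP=> i; rewrite [RHS]mxE.
(* [Q j] kills [x j] and uses whichever of [A] and [B] tells [x j] from [x i]; for j != i one of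
   them does, as the pairs are distinct. *)
pose Q j := if a i == a j then B - (b j)%:M else A - (a j)%:M.
pose lam j l := if a i == a j then b l - b j else a l - a j.
have xQ j l : x l *m Q j = lam j l *: x l.
  by rewrite /Q /lam; case: ifP => _; rewrite mulmxBr mul_mx_scalar ?xA ?xB -scalerBl.
have lam_neq0 j : j != i -> lam j i != 0.
  rewrite /lam => ji; case: ifPn => [/eqP aij|]; rewrite subr_eq0 //.
  by apply: contraNneq ji => bij; apply/eqP/inj_ab; rewrite aij bij.
have lamE j : lam j j = 0 by rewrite /lam; case: ifP; rewrite subrr.
pose app s (z : 'rV_n) := foldr (fun j y => y *m Q j) z s.
have app_x s l : app s (x l) = (\prod_(j <- s) lam j l) *: x l.
  elim: s => [|j s IHs]; rewrite ?big_nil ?scale1r // big_cons /= IHs.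
  by rewrite -scalemxAl xQ scalerA mulrC.
have app_sum s (c : 'I_m -> K) :
    app s (\sum_l c l *: x l) = \sum_l c l *: app s (x l).
  elim: s => //= j s ->; rewrite mulmx_suml.
  by apply: eq_bigr => l _; rewrite scalemxAl.
have app0 s : app s 0 = 0 by elim: s => //= j s ->; rewrite mul0mx.
pose s := [seq j <- enum 'I_m | j != i].
have sum0' : \sum_l u 0 l *: x l = 0.
  by rewrite -[RHS]sum0; apply: eq_bigr => l _; rewrite rowK.
have := congr1 (app s) sum0'.
rewrite app0 app_sum (bigD1 i) // big1 => [|l li]; last first.
  rewrite app_x (big_rem l) /= ?lamE ?mul0r ?scale0r ?scaler0 //.
  by rewrite mem_filter mem_enum andbT.
rewrite /= addr0 app_x => /eqP; rewrite !scaler_eq0 (negPf (x_neq0 i)) orbF.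
case/orP=> /eqP // /eqP; rewrite prodf_seq_eq0 => /hasP[j].
by rewrite mem_filter => /andP[/lam_neq0/negPf-> _].
Qed.

(** * The dimension as the size of an orbit of joint eigenvectors *)

Section Dimension.

Variables (p : nat) (p_prime : prime p) (K : closedFieldType).
Variables (iota : {rmorphism 'F_p -> K}) (pcharKp : p \in [pchar K]).
Hypothesis K_alg : integralRange iota.
Local Notation phi := (frob pcharKp).

(** Each entry is algebraic, hence has a positive period; the product of these periods serves all
    entries. *)
Lemma algebraic_frob_periodic m n (A : 'M[K]_(m, n)) :
  exists2 k, (0 < k)%N & map_mx (phi k) A = A.
Proof.
have ex ij : exists k, (0 < k)%N && (phi k (A ij.1 ij.2) == A ij.1 ij.2).
  have [d deg_d] := adjoin_degree_is_exists (K_alg (A ij.1 ij.2)).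
  exists d; rewrite (adjoin_degree_frob p_prime _ deg_d) dvdnn andbT.
  by case: deg_d => E [j [b [_ _ ->]]]; apply: adim_gt0.
exists (\prod_ij xchoose (ex ij))%N.
  by rewrite prodn_gt0 // => ij; case/andP: (xchooseP (ex ij)).
apply/matrixP=> i j; rewrite mxE (bigD1 (i, j)) //= mulnC.
by apply: frob_periodic; case/andP: (xchooseP (ex (i, j))) => _ /eqP.
Qed.

Variables (m t f n : nat) (X Y : 'M['F_p]_n).
Let A := map_mx iota X.
Let B := map_mx iota Y.
Hypotheses (m_gt0 : (0 < m)%N) (f_gt0 : (0 < f)%N) (co_pt : coprime p t).
Hypotheses (Yf : Y ^+ f = 1) (YX : Y * X = X ^+ (p ^ m) * Y).
Hypothesis generated : forall (z : 'rV_n) k (M : 'M[K]_(k, n)), z != 0 ->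
  (map_mx iota z <= M)%MS -> (M *m A <= M)%MS -> (M *m B <= M)%MS -> row_full M.
Variables (alpha beta : K) (v : 'rV[K]_n) (w : nat).
Hypothesis prim_alpha : t.-primitive_root alpha.
Hypothesis w_beta : forall k, (phi k beta == beta) = (w %| k)%N.
Let r := mul_order t p.
Let s := mul_order t (p ^ m).
Hypotheses (v_neq0 : v != 0) (vA : v *m A = alpha *: v).
Hypothesis vB : v *m B ^+ s = beta *: v.

Let g := gcdn r m.
Let d := lcmn w g.

Let t_gt0 : (0 < t)%N. Proof. exact: prim_order_gt0 prim_alpha. Qed.
Let g_gt0 : (0 < g)%N. Proof. by rewrite gcdn_gt0 m_gt0 orbT. Qed.
Let s_gt0 : (0 < s)%N. Proof. by rewrite mul_order_gt0 ?coprimeXl. Qed.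

Let d_gt0 : (0 < d)%N.
Proof.
(* Positivity of [w] comes from a positive period of [beta], here seen as a 1 by 1 matrix. *)
have [k k_gt0 /matrixP/(_ 0 0)] := algebraic_frob_periodic (beta%:M : 'M_1).
rewrite !mxE eqxx => /eqP; rewrite w_beta => w_k.
by rewrite lcmn_gt0 g_gt0 (dvdn_gt0 k_gt0).
Qed.

Let map_phiA k : map_mx (phi k) A = A.
Proof. exact: map_frob_iota. Qed.

Let map_phiBX k i : map_mx (phi k) (B ^+ i) = B ^+ i.
Proof. by rewrite rmorphXn /= (map_frob_iota p_prime). Qed.

Let Bf : B ^+ f = 1.
Proof. by rewrite -rmorphXn /= Yf rmorph1. Qed.

(** Since B A = A^q B with q = p^m, right multiplication by [B] sends the a-eigenspace of [A] into
    the a^q-eigenspace. *)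
Let eigen_B (x : 'rV_n) a i :
  x *m A = a *: x -> x *m B ^+ i *m A = a ^+ ((p ^ m) ^ i) *: (x *m B ^+ i).
Proof.
have eigenX (y : 'rV_n) b k : y *m A = b *: y -> y *m A ^+ k = b ^+ k *: y.
  move=> yA; elim: k => [|k IHk]; first by rewrite !expr0 mulmx1 scale1r.
  by rewrite exprS exprSr -mulmxE mulmxA yA -scalemxAl IHk scalerA mulrC.
move=> xA; elim: i => [|i IHi]; first by rewrite expr0 mulmx1 expn0 expr1.
have BA : B *m A = A ^+ (p ^ m) *m B.
  by rewrite -map_mxM [Y *m X]YX map_mxM rmorphXn.
rewrite exprSr -mulmxE mulmxA -[LHS]mulmxA BA mulmxA (eigenX _ _ _ IHi).
by rewrite -scalemxAl -exprM -expnSr.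
Qed.

Let orbit_vec (y : 'rV_n) k i := map_mx (phi k) y *m B ^+ i.

Let orbit_vecA y k i : y *m A = alpha *: y ->
  orbit_vec y k i *m A = phi (k + m * i) alpha *: orbit_vec y k i.
Proof.
move=> yA; rewrite (eigen_B (a := phi k alpha)) ?frob_exprX //.
by rewrite -[A](map_phiA k) -map_mxM yA map_mxZ.
Qed.

Let orbit_vecB y k i : y *m B ^+ s = beta *: y ->
  orbit_vec y k i *m B ^+ s = phi k beta *: orbit_vec y k i.
Proof.
move=> yB; rewrite -mulmxA -[B ^+ i *m _]exprD addnC exprD -mulmxE mulmxA.
by rewrite -[B ^+ s](map_phiBX k) -map_mxM yB map_mxZ scalemxAl.
Qed.

(** With this j, applying phi^d and then [B ^+ j] preserves the eigenvalue [alpha]; it preserves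
    [beta] because w divides d. Bezout provides j, since g = gcd(r, m) divides d. *)
Let exists_shift : exists j, (r %| d + m * j)%N.
Proof.
have r_gt0 : (0 < r)%N by rewrite mul_order_gt0.
have [a _ r_ga] := Bezoutl m r_gt0.
exists (d %/ g * a)%N; rewrite -{1}(divnK (dvdn_lcmr w g : g %| d)%N).
by rewrite mulnCA -mulnDr dvdn_mull // mulnC.
Qed.

Let period_alpha k : (phi k alpha == alpha) = (r %| k)%N.
Proof. exact: frob_prim_root. Qed.

Lemma exists_fixed_eigenvector : exists (y : 'rV_n) j,
  [/\ y != 0, y *m A = alpha *: y, y *m B ^+ s = beta *: y & orbit_vec y d j = y].
Proof.
have [j r_dj] := exists_shift.
have [N N_gt0 vN] := algebraic_frob_periodic v.
pose W := (eigenspace A alpha :&: eigenspace (B ^+ s) beta)%MS.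
have WP (x : 'rV_n) :
    reflect (x *m A = alpha *: x /\ x *m B ^+ s = beta *: x) (x <= W)%MS.
  rewrite sub_capmx; apply: (iffP andP) => [[/eigenspaceP xA /eigenspaceP]|[xA xB]] //.
  by split; apply/eigenspaceP.
have iterE l : iter l (orbit_vec^~ d ^~ j) v = map_mx (phi (d * l)) v *m B ^+ (j * l).
  elim: l => [|l IHl].
    rewrite !muln0 expr0 mulmx1; apply/matrixP=> i k.
    by rewrite mxE /frob expn0 expr1.
  rewrite iterS IHl /orbit_vec map_mxM map_phiBX -map_frobD -mulnS.
  by rewrite -mulmxA -[B ^+ _ *m _]exprD addnC -mulnS.
(* The number of iterations [N * f] is a period of [v]: [N] takes care of the coordinates and [f] of
   the power of [B]. *)
have [||||||y [y_neq0 /WP[yA yB] fix_y]] :=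
  @semilinear_fixed K p pcharKp d (N * f) n n (B ^+ j) W v.
- exact: d_gt0.
- by rewrite muln_gt0 N_gt0.
- exact: v_neq0.
- rewrite [LHS]iterE [(j * _)%N]mulnA [(j * N * f)%N]mulnC exprM Bf expr1n mulmx1.
  rewrite mulnA mulnAC.
  apply/matrixP=> a b; move/matrixP/(_ a b): vN; rewrite !mxE.
  exact: frob_periodic.
- exact/WP.
- move=> x /WP[xA xB]; apply/WP; split.
    rewrite [LHS]orbit_vecA //; congr (_ *: _).
    by apply/eqP; rewrite period_alpha.
  rewrite [LHS]orbit_vecB //; congr (_ *: _).
  by apply/eqP; rewrite w_beta dvdn_lcml.
by exists y, j.
Qed.

Lemma orbit_dim : n = (d * s)%N.
Proof.
have [y [j [y_neq0 yA yB fix_y]]] := exists_fixed_eigenvector.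
(* Row l stands for the pair (k, i) with l = k s + i and i < s. *)
pose M : 'M_(d * s, n) := \matrix_l orbit_vec y (l %/ s) (l %% s).
have orbB k i l : orbit_vec y k i *m B ^+ l = orbit_vec y k (i + l).
  by rewrite /orbit_vec -mulmxA exprD.
have orb_shift k i : orbit_vec y (k + d) (i + j) = orbit_vec y k i.
  rewrite -[in RHS]fix_y /orbit_vec map_mxM map_phiBX -map_frobD -mulmxA.
  by rewrite -[B ^+ j *m _]exprD [(j + i)%N]addnC.
have orb_period k i l : orbit_vec y k (i + f * l) = orbit_vec y k i.
  by rewrite /orbit_vec exprD exprM Bf expr1n mulr1.
have orb_small k i : (k < d)%N -> (orbit_vec y k i <= M)%MS.
  move=> k_d; have lt_l : (k * s + i %% s < d * s)%N.
    apply: (@leq_trans (k.+1 * s)); last by rewrite leq_mul2r k_d orbT.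
    by rewrite mulSn addnC ltn_add2r ltn_pmod.
  have := row_sub (Ordinal lt_l) M; rewrite rowK /=.
  rewrite divnMDl // (divn_small (ltn_pmod _ s_gt0)) addn0 modnMDl modn_mod.
  rewrite {2}(divn_eq i s) addnC.
  (* Each further factor [B ^+ s] only multiplies the vector by a conjugate of [beta]. *)
  elim: (i %/ s)%N => [|a IHa] orbM; first by rewrite mul0n addn0.
  rewrite mulSn addnCA addnC -orbB orbit_vecB //.
  exact/scalemx_sub/IHa.
have orb_sub k i : (orbit_vec y k i <= M)%MS.
  elim/ltn_ind: k i => k IHk i; have [/orb_small // | le_dk] := ltnP k d.
  (* Adding [f * j] to i changes nothing, as B^f = 1, and makes room to subtract j, so that
     [orb_shift] lowers k by d. *)
  have le_jfj : (j <= f * j)%N by rewrite leq_pmull.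
  rewrite -(orb_period _ _ j) -(subnK le_jfj) addnA -(subnK le_dk) orb_shift.
  by apply: IHk; rewrite ltn_subrL d_gt0 (leq_trans d_gt0).
(* [semilinear_fixed] for the plain Frobenius (identity matrix, d = 1) on the row space of [M]; a
   fixed vector has coordinates in the prime field. *)
have [z z_neq0 Mz] : exists2 z : 'rV_n, z != 0 & (map_mx iota z <= M)%MS.
  have [N N_gt0 yN] := algebraic_frob_periodic y.
  have [||||||x [x_neq0 Mx]] :=
    @semilinear_fixed K p pcharKp 1 N n (d * s) 1 M y.
  - by [].
  - by [].
  - by [].
  - rewrite -[RHS]yN; elim: (N) => [|l IHl].
      by apply/matrixP=> a b; rewrite mxE /frob expn0 expr1.
    by rewrite iterS IHl mulmx1 -map_frobD.
  - have := orb_sub 0 0; rewrite /orbit_vec expr0 mulmx1; congr (_ <= _)%MS.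
    by apply/matrixP=> a b; rewrite mxE /frob expn0 expr1.
  - move=> x /submxP[c ->]; rewrite mulmx1 map_mxM mulmx_sub //.
    apply/row_subP=> l; rewrite -map_row rowK /orbit_vec map_mxM map_phiBX.
    by rewrite -map_frobD orb_sub.
  rewrite mulmx1 => /(@frob1_fixed_mx _ p_prime _ iota)[z xE]; exists z; rewrite -?xE //.
  by rewrite -(map_mx_eq0 iota) -xE.
have full_M : row_full M.
  apply: (generated z_neq0 Mz); apply/row_subP=> l; rewrite row_mul rowK.
    by rewrite orbit_vecA // scalemx_sub // orb_sub.
  by rewrite -[B]expr1 orbB orb_sub.
suff /eqP free_M : row_free M by rewrite -free_M; apply/esym/eqP.
apply: (@joint_eigenvectors_free _ _ _ A (B ^+ s) _
  (fun l => phi (l %/ s + m * (l %% s)) alpha) (fun l => phi (l %/ s) beta)).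
- move=> l; apply: contraNneq y_neq0 => orb0.
  (* A power B^i is undone by B^(f i - i), which stays within natural exponents. *)
  have le_ifi : (l %% s <= f * (l %% s))%N by rewrite leq_pmull.
  rewrite -(map_mx_eq0 (phi (l %/ s))) -[X in X == _]mulmx1 -[1%:M](expr0 B).
  rewrite -/(orbit_vec y (l %/ s) 0) -(orb_period _ _ (l %% s)%N) add0n.
  by rewrite -(subnKC le_ifi) -orbB orb0 mul0mx.
- by move=> l; apply: orbit_vecA.
- by move=> l; apply: orbit_vecB.
move=> l l' [] /eqP; rewrite (frob_eq_mod period_alpha) => eq_r /eqP.
rewrite (frob_eq_mod w_beta) => eq_w.
(* As g divides m, the eigenvalue of [A] determines k modulo g; that of [B ^+ s] gives k modulo w,
   hence k modulo d and k itself. *)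
have mod_g (k i : nat) : ((k + m * i) %% r %% g = k %% g)%N.
  rewrite modn_dvdm ?dvdn_gcdl // -modnDmr.
  by rewrite (eqP (dvdn_mulr i (dvdn_gcdr r m))) addn0.
have lt_d (i : 'I_(d * s)) : (i %/ s < d)%N by rewrite ltn_divLR.
have eq_k : (l %/ s = l' %/ s)%N.
  have /eqP : (l %/ s == l' %/ s %[mod d])%N.
    by rewrite eqn_mod_lcm eq_w -(mod_g _ (l %% s)%N) (eqP eq_r) mod_g /=.
  by rewrite !modn_small.
apply: ord_inj; rewrite (divn_eq l s) (divn_eq l' s) -eq_k.
move: eq_r; rewrite -eq_k eqn_modDl => eq_r; congr (_ + _)%N.
have lt_s (i : 'I_(d * s)) : (i %% s < s)%N by rewrite ltn_mod.
rewrite -(modn_small (lt_s l)) -(modn_small (lt_s l')); apply/eqP.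
(* With k cancelled, m a = m b modulo r means a = b modulo s, as s is the order of p^m. *)
move: eq_r; move: (l %% s)%N (l' %% s)%N => a b.
wlog le_ba : a b / (b <= a)%N.
  move=> W; case: (leqP b a) => [/W //|/ltnW le_ab]; rewrite eq_sym.
  by move=> /(W _ _ le_ab); rewrite eq_sym.
by rewrite !eqn_mod_dvd ?leq_mul2l ?le_ba ?orbT // -mulnBr dvdn_mul_order_exp.
Qed.

End Dimension.

(** * Eigenvectors from characters, and irreducibility after extension of scalars *)

(** The size is a variable so that m = 1 can be substituted; at size [\rank U] the equation is only
    propositional. *)
Lemma mx_tr_rank1 (R : pzRingType) (m : nat) (A : 'M[R]_m) (x : 'rV_m) :
  m = 1%N -> x *m A = x *m (\tr A)%:M.
Proof.
move=> m1; subst m; congr (_ *m _).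
by rewrite {1}[A]mx11_scalar /mxtrace big_ord1.
Qed.

Section Representations.

Variables (F : fieldType) (gT : finGroupType) (G : {group gT}) (n : nat).
Variable rG : mx_representation F G n.

Lemma repr_mx_expg m x : x \in G -> rG (x ^+ m)%g = rG x ^+ m.
Proof.
move=> Gx; elim: m => [|m IHm]; first by rewrite repr_mx1.
by rewrite expgS repr_mxM ?groupX // IHm exprS -mulmxE.
Qed.

Lemma submod_rank1_eigenvector (U : 'M_n) (modU : mxmodule rG U) :
    \rank U = 1%N ->
  exists2 v : 'rV_n, v != 0
    & {in G, forall x, v *m rG x = \tr (submod_repr modU x) *: v}.
Proof.
move=> rU1; pose v0 : 'rV[F]_(\rank U) := const_mx 1.
have v0_neq0 : v0 != 0.
  have i : 'I_(\rank U) by rewrite rU1; exact: ord0.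
  by apply/rV0Pn; exists i; rewrite mxE oner_eq0.
exists (val_submod v0) => [|x Gx]; first by rewrite val_submod_eq0.
rewrite -(val_submodJ modU) // (mx_tr_rank1 _ _ rU1) mul_mx_scalar.
by rewrite linearZ.
Qed.

Variables (K : fieldType) (iota : {rmorphism F -> K}).

(** The fixed space of a normal subgroup is a submodule defined over F. A nonzero fixed vector over
    K makes it nonzero, so it is everything by irreducibility over F. *)
Lemma irr_trivial_normal_cycle x (v : 'rV[K]_n) : mx_irreducible rG ->
  (<[x]> <| G)%g -> v != 0 -> v *m map_mx iota (rG x) = v -> rG x = 1%:M.
Proof.
case=> _ _ irr nXG v_neq0 vx; have Gx : x \in G.
  by apply: (subsetP (normal_sub nXG)); apply: cycle_id.
have fix_v : (v <= map_mx iota (rfix_mx rG <[x]>))%MS.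
  rewrite map_rfix_mx; apply/rfix_mxP => _ /cycleP[k ->].
  rewrite map_reprE repr_mx_expg //; elim: k => [|k IHk].
    by rewrite expr0 map_mx1 mulmx1.
  by rewrite exprS -mulmxE map_mxM mulmxA vx.
have := irr _ (normal_rfix_mx_module rG nXG); rewrite submx1 => /(_ isT).
have -> : rfix_mx rG <[x]> != 0.
  by apply: contraNneq v_neq0 => fix0; move: fix_v; rewrite fix0 map_mx0 submx0.
move=> /(_ isT)/rfix_mxP/(_ x (cycle_id x)); by rewrite mul1mx.
Qed.

(** Over F the translates of z span everything; their images lie in [M]. This supplies the
    hypothesis [generated] of the dimension count, where [M] need not be defined over F. *)
Lemma irr_generated (z : 'rV[F]_n) k (M : 'M[K]_(k, n)) : mx_irreducible rG ->
    z != 0 -> (map_mx iota z <= M)%MS ->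
    {in G, forall x, (M *m map_mx iota (rG x) <= M)%MS} -> row_full M.
Proof.
case=> _ _ irr z_neq0 Mz modM.
have := irr _ (cyclic_mx_module rG z); rewrite submx1 cyclic_mx_eq0 => /(_ isT).
move=> /(_ z_neq0); rewrite -(map_submx iota) map_mx1 sub1mx => full_z.
rewrite -sub1mx; apply: submx_trans (_ : map_mx iota (cyclic_mx rG z) <= M)%MS.
  by rewrite sub1mx.
apply/row_subP=> i; rewrite -map_row.
have [A /envelop_mxP[a ->] ->] := @cyclic_mxP _ _ _ _ rG z _ (row_sub i (cyclic_mx rG z)).
rewrite mulmx_sumr raddf_sum; apply: summx_sub => x Gx /=.
rewrite -scalemxAr map_mxZ map_mxM scalemx_sub //.
by apply: submx_trans (modM x Gx); apply: submxMr.
Qed.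

End Representations.

(** * Quotients of a cyclic group and their centralisers *)

Section Groups.

Variables (gT : finGroupType) (tau : gT) (T0 : {group gT}).
Hypothesis sT0 : T0 \subset <[tau]>%g.
Local Notation t := #|<[tau]> / T0|%g.

Lemma sub_cycle_normal (x : gT) (A : {group gT}) :
  A \subset <[x]>%g -> (A <| <[x]>)%g.
Proof. by move=> sA; apply/char_normal/cycle_subgroup_char. Qed.

Lemma dvdn_card_cycle_quotient a : (t %| a)%N = ((tau ^+ a)%g \in T0).
Proof.
have Ntau : tau \in 'N(T0)%g.
  by rewrite (subsetP (normal_norm (sub_cycle_normal sT0))) ?cycle_id.
rewrite quotient_cycle // -[#|_|]/(#[coset T0 tau])%g order_dvdn -morphX //.
apply/eqP/idP; last exact: coset_id.
by apply: coset_idr; rewrite groupX.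
Qed.

(** It suffices to commute with the coset of [tau], which generates the quotient and has order t. *)
Lemma mem_astab_quotient_cycle (y : gT) b : y \in 'N(T0)%g ->
    (y * tau = tau ^+ b * y)%g -> b = 1 %[mod t] ->
  y \in 'C(<[tau]> / T0 | 'Q)%g.
Proof.
move=> Ny ytau b1; have Ntau : tau \in 'N(T0)%g.
  by rewrite (subsetP (normal_norm (sub_cycle_normal sT0))) ?cycle_id.
rewrite astabQ mem_morphpre // quotient_cycle // cent_cycle.
apply/cent1P; rewrite /commute -!morphM //= ytau !morphM ?groupX //.
congr (_ * _)%g; rewrite morphX // -(expg_mod_order _ b).
rewrite -[#[_]%g]/(#|<[coset T0 tau]>|%g) -quotient_cycle // b1.
by rewrite quotient_cycle // -orderE expg_mod_order expg1.
Qed.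

End Groups.

(** * The dimension formula for the semidirect product *)

Theorem proposition4p2
  (p fK q e f : nat) (p_prime : prime p) (fK_gt0 : (0 < fK)%N)
  (def_q : q = (p ^ fK)%N)
  (gT : finGroupType) (tau upsilon : gT) (G T U : {group gT})
  (defT : T :=: <[tau]>%g) (defU : U :=: <[upsilon]>%g)
  (defG : (T ><| U)%g = G)
  (cardT : #|T| = e) (cardU : #|U| = f)
  (coprime_ep : coprime e p) (e_dvd : (e %| q ^ f - 1)%N)
  (upsilon_act :
     forall x, x \in T -> (upsilon * x * upsilon^-1)%g = (x ^+ q)%g)
  (n : nat) (rho : mx_representation 'F_p G n) (rho_irr : mx_irreducible rho)
  (sTG : T \subset G) (T0 : {group gT})
  (defT0 : T0 :=: rker (subg_repr rho sTG))
  (t : nat) (def_t : t = #|(T / T0)%g|)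
  (Ut : {group gT}) (defUt : Ut :=: ('C_U((T / T0)%g | 'Q))%g)
  (s : nat) (def_s : s = mul_order t q)
  (H : {group gT}) (defH : (T ><| Ut)%g = H) (sHG : H \subset G)
  (Fpbar : closedFieldType) (iota : {rmorphism 'F_p -> Fpbar})
  (Fpbar_alg : integralRange iota)
  (W : 'M[Fpbar]_n)
  (modW : mxmodule (subg_repr (map_repr iota rho) sHG) W)
  (dimW : \rank W = 1%N)
  (chi : gT -> Fpbar)
  (def_chi : forall h, h \in H -> chi h = \tr (submod_repr modW h))
  (beta : Fpbar) (def_beta : beta = chi (upsilon ^+ s)%g)
  (r : nat) (def_r : r = mul_order t p)
  (w : nat) (def_w : adjoin_degree_is iota beta w) :
  n = lcmn ((r * w) %/ gcdn r fK) r.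
Proof.
have [_ defTU nTU _] := sdprodP defG.
have [_ defTUt _ _] := sdprodP defH.
have Ttau : tau \in T by rewrite defT cycle_id.
have Uups : upsilon \in U by rewrite defU cycle_id.
have sUG : U \subset G by rewrite -defTU mulG_subr.
have Gtau : tau \in G := subsetP sTG _ Ttau.
have Gups : upsilon \in G := subsetP sUG _ Uups.
have nTG : (T <| G)%g.
  by rewrite /normal sTG -defTU mulG_subG normG.
have sT0 : T0 \subset <[tau]>%g by rewrite -defT defT0 rstab_sub.
have nT0G : (T0 <| G)%g.
  by apply: char_normal_trans nTG; rewrite defT cycle_subgroup_char.
have tE : t = #|(<[tau]> / T0)%g| by rewrite def_t defT.
have t_gt0 : (0 < t)%N by rewrite def_t cardG_gt0.
have co_pt : coprime p t.
  rewrite coprime_sym; apply: coprime_dvdl coprime_ep.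
  by rewrite def_t -cardT dvdn_quotient.
have s_gt0 : (0 < s)%N by rewrite def_s def_q mul_order_gt0 ?coprimeXl.
have ups_tau i : (upsilon ^+ i * tau = tau ^+ (q ^ i) * upsilon ^+ i)%g.
  elim: i => [|i IHi]; first by rewrite !expg0 mul1g mulg1.
  rewrite expgS -mulgA IHi mulgA -[(upsilon * _)%g](mulgKV upsilon).
  by rewrite upsilon_act ?groupX // -expgM -expnSr -mulgA.
(* Conjugation by upsilon^s raises tau to the power q^s, and q^s = 1 modulo t. *)
have Hups : (upsilon ^+ s)%g \in H.
  rewrite -defTUt (subsetP (mulG_subr T Ut)) // defUt inE groupX //= defT.
  apply: (mem_astab_quotient_cycle sT0 _ (ups_tau s)).
    by rewrite groupX // (subsetP (normal_norm nT0G)).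
  by rewrite -tE; apply/eqP; rewrite -mul_orderP ?def_s // def_q coprimeXl.
have Htau : tau \in H by rewrite -defTUt (subsetP (mulG_subl Ut T)).
have [v v_neq0 vH] := submod_rank1_eigenvector modW dimW.
have vtau : v *m map_mx iota (rho tau) = chi tau *: v.
  by rewrite def_chi // -vH.
have vups : v *m map_mx iota (rho (upsilon ^+ s)%g) = beta *: v.
  by rewrite def_beta def_chi // -vH.
have pcharKp : p \in [pchar Fpbar] by rewrite (fmorph_pchar iota) pchar_Fp.
(* If chi(tau)^a = 1 then tau^a fixes v, hence acts trivially on V, since it generates a normal
   subgroup. So a is then a multiple of t, and conversely. *)
have prim_alpha : t.-primitive_root (chi tau).
  have vtauX a : v *m map_mx iota (rho (tau ^+ a)%g) = chi tau ^+ a *: v.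
    rewrite repr_mx_expg //; elim: a => [|a IHa].
      by rewrite expr0 map_mx1 mulmx1 scale1r.
    by rewrite exprS -mulmxE map_mxM mulmxA vtau -scalemxAl IHa scalerA -exprS.
  have alphaX a : (chi tau ^+ a == 1) = (t %| a)%N.
    rewrite tE dvdn_card_cycle_quotient // defT0; apply/eqP/rkerP=> [a1|[_ rho1]].
      split; first by rewrite groupX.
      apply: (irr_trivial_normal_cycle (iota := iota) (v := v) rho_irr) => //.
        by apply: char_normal_trans nTG; rewrite defT cycle_subgroup_char ?cycleX.
      by rewrite vtauX a1 scale1r.
    have := vtauX a; rewrite [rho _]rho1 map_mx1 mulmx1 -{1}[v]scale1r => /eqP.
    rewrite -subr_eq0 -scalerBl scaler_eq0 (negPf v_neq0) orbF subr_eq0.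
    by move/eqP.
  (* The index i < t stands for the exponent i + 1, of which only i + 1 = t is a multiple of t. *)
  apply/andP; split=> //; apply/forallP=> i; rewrite unity_rootE alphaX.
  apply/eqP; apply/idP/eqP=> [/dvdn_leq t_i|->//].
  by apply/eqP; rewrite eqn_leq ltn_ord t_i.
pose X := rho tau; pose Y := rho upsilon.
rewrite (@orbit_dim p p_prime Fpbar iota pcharKp Fpbar_alg fK t f n X Y
  fK_gt0 _ co_pt _ _ _ (chi tau) beta v w prim_alpha) //.
- by rewrite mul_order_exp // def_r lcmn_gcdn_div // gcdn_gt0 fK_gt0 orbT.
- by rewrite -cardU cardG_gt0.
- by rewrite -repr_mx_expg // -cardU defU expg_order repr_mx1.
- rewrite -repr_mx_expg // -!mulmxE -!repr_mxM ?groupX //.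
  by have := ups_tau 1%N; rewrite !expg1 expn1 -def_q => ->.
- move=> z k M z_neq0 Mz MX MY; apply: (irr_generated rho_irr z_neq0 Mz) => x.
  have stabX (g : gT) : g \in G -> (M *m map_mx iota (rho g) <= M)%MS ->
      forall i, (M *m map_mx iota (rho (g ^+ i)%g) <= M)%MS.
    move=> Gg Mg; elim=> [|i IHi]; first by rewrite repr_mx1 map_mx1 mulmx1.
    rewrite expgS repr_mxM ?groupX // map_mxM mulmxA.
    exact: submx_trans (submxMr _ Mg) IHi.
  rewrite -{1}defTU => /mulsgP[g h].
  rewrite defT defU => /cycleP[i ->] /cycleP[j ->] ->.
  rewrite repr_mxM ?groupX // map_mxM mulmxA.
  exact: submx_trans (submxMr _ (stabX _ Gtau MX i)) (stabX _ Gups MY j).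
- exact: adjoin_degree_frob def_w.
- by rewrite -def_q -def_s -rmorphXn -repr_mx_expg.
Qed.
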